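(* The modal logic $\mathsf{S4}$ is sound for reflexive provability models with necessitation, local soundness and local completeness: if $\mathsf{S4}\vdash A$ and $\mathcal P$ is such a model, then $\mathcal P,w\Vdash A$ for every world $w$. Moreover, the same holds if the requirement of necessitation is replaced by transitivity of the accessibility relation.
   Context: $\mathsf{S4}$ is $\mathsf K$ (the smallest normal modal logic) plus $\Box A\to\Box\Box A$ and $\Box A\to A$. Language $\mathcal L_\Box$: formulas built from atomic propositions and $\bot$ using $\to$ and a unary $\Box$. A formula is purely modal if it is a Boolean combination of formulas $\Box B$. A theory is a pair of a set of axioms and a set of inference rules (finitely many premises, one conclusion); $\mathsf T\vdash A$ means derivability from axioms by rules. A theory is classical if modus ponens is one of its rules and all classical tautologies are derivable. A provability pre-model is $\mathcal P=(W,\sqsubset,\{L_w\}_{w\in W^\sqsubset},V)$ with $W$ nonempty, $\sqsubset$ a binary relation on $W$, $V\subseteq W\times\mathrm{atoms}$, $W^\sqsubset=\{u:\exists v\,(v\sqsubset u)\}$, and a theory $L_w$ for each $w\in W^\sqsubset$. Satisfaction: atoms via $V$, $\bot$ never holds, $\to$ classical, $\mathcal P,w\Vdash\Box A$ iff $L_u\vdash A$ for all $u$ with $w\sqsubset u$. With $\sqsubset^+$ the transitive closure, $\mathcal P,w\Vdash^+A$ iff there is $u\sqsubset w$ with $\mathcal P,v\Vdash A$ for all $v$ such that $u\sqsubset^+v$. A provability model is a pre-model in which every $L_w$ is classical and which satisfies modal completeness: for every $w\in W^\sqsubset$ and purely modal $A$, $\mathcal P,w\Vdash^+A$ implies $L_w\vdash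 A$. Necessitation: every $L_w$ has the rule ''from $A$ infer $\Box A$''. Local completeness: for every $w\in W^\sqsubset$ and every formula $A$ (not necessarily purely modal), $\mathcal P,w\Vdash^+A$ implies $L_w\vdash A$. Local soundness: for every $w\in W^\sqsubset$ and every $A$, $L_w\vdash A$ implies $\mathcal P,w\Vdash A$. Reflexive/transitive refer to $\sqsubset$. *)

(* Defs.v *)
From Stdlib Require Import Bool List Relations.
Import ListNotations.

Set Implicit Arguments.

Inductive form (atom : Type) : Type :=
| Atom (p : atom)
| Bot
| Imp (A B : form atom)
| Box (A : form atom).

Arguments Bot {atom}.

Fixpoint subst (atom : Type) (s : atom -> form atom) (A : form atom)
  : form atom :=
  match A with
  | Atom p => s p
  | Bot => Bot
  | Imp B C => Imp (subst s B) (subst s C)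
  | Box B => Box (subst s B)
  end.

(* Boxed formulas are treated as propositional variables: [vbox B] is the truth
   value given to [Box B]. *)
Fixpoint beval (atom : Type) (vat : atom -> bool) (vbox : form atom -> bool)
  (A : form atom) : bool :=
  match A with
  | Atom p => vat p
  | Bot => false
  | Imp B C => implb (beval vat vbox B) (beval vat vbox C)
  | Box B => vbox B
  end.

Definition tautology (atom : Type) (A : form atom) : Prop :=
  forall vat vbox, beval vat vbox A = true.

Inductive purely_modal (atom : Type) : form atom -> Prop :=
| pm_box B : purely_modal (Box B)
| pm_bot : purely_modal Bot
| pm_imp A B : purely_modal A -> purely_modal B -> purely_modal (Imp A B).

Record normal_logic (atom : Type) (L : form atom -> Prop) : Prop := {
  normal_taut : forall A, tautology A -> L A;
  normal_K : forall A B, L (Imp (Box (Imp A B)) (Imp (Box A) (Box B)));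
  normal_mp : forall A B, L A -> L (Imp A B) -> L B;
  normal_nec : forall A, L A -> L (Box A);
  normal_subst : forall s A, L A -> L (subst s A)
}.

Definition S4 (atom : Type) (A : form atom) : Prop :=
  forall L : form atom -> Prop,
    normal_logic L ->
    (forall B, L (Imp (Box B) (Box (Box B)))) ->
    (forall B, L (Imp (Box B) B)) ->
    L A.

(* An inference rule, as the set of its instances: [r prems concl]. *)
Definition rule (atom : Type) : Type := list (form atom) -> form atom -> Prop.

Record theory (atom : Type) : Type := {
  axioms : form atom -> Prop;
  rules : rule atom -> Prop
}.

Inductive derivable (atom : Type) (T : theory atom) : form atom -> Prop :=
| der_axiom A : axioms T A -> derivable T A
| der_rule (r : rule atom) prems A :
    rules T r -> r prems A ->
    (forall B, In B prems -> derivable T B) ->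
    derivable T A.

Inductive modus_ponens (atom : Type) : rule atom :=
| mp_instance A B : modus_ponens [A; Imp A B] B.

Inductive necessitation_rule (atom : Type) : rule atom :=
| nec_instance A : necessitation_rule [A] (Box A).

Definition classical_theory (atom : Type) (T : theory atom) : Prop :=
  rules T (@modus_ponens atom) /\ forall A, tautology A -> derivable T A.

(* The family of theories is a total function on worlds; its values outside
   [has_pred] (the set of worlds with a predecessor) are irrelevant, since every
   notion below consults it on that set only. *)
Record premodel (atom : Type) : Type := {
  world : Type;
  world_inhabited : inhabited world;
  acc : relation world;
  thy : world -> theory atom;
  val : world -> atom -> Prop
}.

Definition has_pred (atom : Type) (P : premodel atom) (u : world P) : Prop :=
  exists v, acc P v u.

Fixpoint sat (atom : Type) (P : premodel atom) (w : world P) (A : form atom)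
  : Prop :=
  match A with
  | Atom p => val P w p
  | Bot => False
  | Imp B C => sat P w B -> sat P w C
  | Box B => forall u, acc P w u -> derivable (thy P u) B
  end.

Definition sat_plus (atom : Type) (P : premodel atom) (w : world P)
  (A : form atom) : Prop :=
  exists u, acc P u w /\
    forall v, clos_trans (world P) (acc P) u v -> sat P v A.

Definition modal_completeness (atom : Type) (P : premodel atom) : Prop :=
  forall w, has_pred P w -> forall A,
    purely_modal A -> sat_plus P w A -> derivable (thy P w) A.

Definition provability_model (atom : Type) (P : premodel atom) : Prop :=
  (forall w, has_pred P w -> classical_theory (thy P w)) /\
  modal_completeness P.

Definition necessitation (atom : Type) (P : premodel atom) : Prop :=
  forall w, has_pred P w -> rules (thy P w) (@necessitation_rule atom).

Definition local_completeness (atom : Type) (P : premodel atom) : Prop :=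
  forall w, has_pred P w -> forall A,
    sat_plus P w A -> derivable (thy P w) A.

Definition local_soundness (atom : Type) (P : premodel atom) : Prop :=
  forall w, has_pred P w -> forall A,
    derivable (thy P w) A -> sat P w A.

(* Main.v *)
Require Import Defs.
From Stdlib Require Import Bool List Relations ClassicalEpsilon.

Set Implicit Arguments.

(** The formulas all of whose substitution instances hold at every world form a
    normal logic: closure under necessitation is local completeness, with [w]
    itself as the witness of [sat_plus], and axiom T is local soundness at a
    reflexive world.  Axiom 4 says that [L_u] proves [Box B] whenever [Box B]
    holds at a predecessor [w] of [u]; the necessitation rule gives this from
    [L_u] proving [B], and transitivity gives it from modal completeness, since
    [Box B] then persists to all worlds above [w]. *)

Definition valid_instances (atom : Type) (P : premodel atom) (A : form atom)
  : Prop :=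
  forall (s : atom -> form atom) (w : world P), sat P w (subst s A).

(** [tautology] quantifies over boolean valuations while [sat] is a proposition, so excluded middle
    is needed to pass between them. *)
Definition truth_value (Q : Prop) : bool :=
  if excluded_middle_informative Q then true else false.

Lemma truth_value_true (Q : Prop) : truth_value Q = true <-> Q.
Proof.
  unfold truth_value.
  destruct (excluded_middle_informative Q); split; congruence || tauto.
Qed.

Lemma subst_subst (atom : Type) (s t : atom -> form atom) (A : form atom) :
  subst t (subst s A) = subst (fun p => subst t (s p)) A.
Proof. induction A; simpl; congruence. Qed.

(** At a fixed world [Imp] is read classically and boxed formulas behave like atoms, so the [Box]
    case needs no induction hypothesis. *)
Lemma sat_subst_beval (atom : Type) (P : premodel atom) (w : world P)
  (s : atom -> form atom) (A : form atom) :
  beval (fun p => truth_value (sat P w (s p)))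
        (fun B => truth_value (sat P w (Box (subst s B)))) A = true
  <-> sat P w (subst s A).
Proof.
  induction A as [p| |B IHB C IHC|B _].
  - apply truth_value_true.
  - simpl; split; [discriminate | tauto].
  - cbn [beval subst sat]. rewrite <- IHB, <- IHC. apply implb_true_iff.
  - apply truth_value_true.
Qed.

Lemma valid_instances_tautology (atom : Type) (P : premodel atom)
  (A : form atom) :
  tautology A -> valid_instances P A.
Proof. intros HA s w. apply sat_subst_beval, HA. Qed.

Lemma derivable_mp (atom : Type) (T : theory atom) (A B : form atom) :
  rules T (@modus_ponens atom) ->
  derivable T A -> derivable T (Imp A B) -> derivable T B.
Proof.
  intros Hmp HA HAB.
  apply (der_rule _ _ _ Hmp (mp_instance A B)).
  intros C [<-|[<-|[]]]; assumption.
Qed.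

Lemma derivable_nec (atom : Type) (T : theory atom) (A : form atom) :
  rules T (@necessitation_rule atom) -> derivable T A -> derivable T (Box A).
Proof.
  intros Hnec HA.
  apply (der_rule _ _ _ Hnec (nec_instance A)).
  intros C [<-|[]]; assumption.
Qed.

Lemma valid_instances_normal (atom : Type) (P : premodel atom) :
  (forall w, has_pred P w -> classical_theory (thy P w)) ->
  local_completeness P ->
  normal_logic (valid_instances P).
Proof.
  intros Hcl Hlc. split.
  - apply valid_instances_tautology.
  - intros A B s w HAB HA u Hwu.
    (* Axiom K is modus ponens inside the theory of each successor [u]. *)
    apply (derivable_mp (A := subst s A)).
    + apply (Hcl u). now exists w.
    + now apply HA.
    + now apply HAB.
  - intros A B HA HAB s w. apply (HAB s w), HA.
  - intros A HA s w u Hwu. apply Hlc.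
    + now exists w.
    + exists w. split; [assumption|]. intros v _. apply HA.
  - intros t A HA s w. rewrite subst_subst. apply HA.
Qed.

(** The last hypothesis isolates axiom 4, the only point at which necessitation and transitivity are
    used differently. *)
Lemma S4_sound (atom : Type) (A : form atom) (P : premodel atom) :
  S4 A ->
  provability_model P ->
  reflexive (world P) (acc P) ->
  local_soundness P ->
  local_completeness P ->
  (forall w u B, acc P w u -> sat P w (Box B) -> derivable (thy P u) (Box B)) ->
  forall w : world P, sat P w A.
Proof.
  intros HA [Hcl _] Hrefl Hls Hlc H4 w.
  (* The identity substitution recovers [A] from its instances. *)
  assert (Hid : forall B : form atom, subst (@Atom atom) B = B)
    by (intro B; induction B; simpl; congruence).
  rewrite <- (Hid A).
  revert w. apply (HA (valid_instances P)).
  - now apply valid_instances_normal.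
  - intros B s w HB u Hwu. now apply (H4 w).
  - intros B s w HB. apply Hls.
    + exists w. apply Hrefl.
    + apply HB, Hrefl.
Qed.

Lemma clos_trans_transitive (W : Type) (R : relation W) (x y : W) :
  transitive W R -> clos_trans W R x y -> R x y.
Proof. intros Htr H. induction H; eauto. Qed.

Theorem theorem3p11 (atom : Type) (A : form atom) (hA : S4 A) :
  (forall P : premodel atom,
     provability_model P ->
     reflexive (world P) (acc P) ->
     necessitation P ->
     local_soundness P ->
     local_completeness P ->
     forall w : world P, sat P w A)
  /\
  (forall P : premodel atom,
     provability_model P ->
     reflexive (world P) (acc P) ->
     transitive (world P) (acc P) ->
     local_soundness P ->
     local_completeness P ->
     forall w : world P, sat P w A).
Proof.
  split.
  - intros P HP Hrefl Hnec Hls Hlc. apply S4_sound; try assumption.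
    intros w u B Hwu HB. apply derivable_nec.
    + apply Hnec. now exists w.
    + now apply HB.
  - intros P HP Hrefl Htr Hls Hlc. apply S4_sound; try assumption.
    intros w u B Hwu HB. apply (proj2 HP).
    + now exists w.
    + constructor.
    + exists w. split; [assumption|]. intros v Hwv x Hvx.
      apply HB, (Htr w v x); [|assumption].
      now apply clos_trans_transitive.
Qed.
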